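(* Let $(X,d)$ be a compact metric space and let $F:X\to[0,+\infty]$ be continuous. Let $G,H:[0,\infty)\to[0,\infty)$ be continuous such that $a\to0$ whenever $H(a)\to0$, and $G(a)\to0$ whenever $a\to0$. Let $x:[0,\infty)\to X$ be continuous with $\liminf_{t\to\infty}F(x(t))=0$, and suppose that $x$ is $(G,H)$-quasi-Fejér monotone w.r.t. $F$ with a continuous error function $e$. Then $x(t)$ converges, as $t\to\infty$, to some point of $\mathrm{zer}F$.
   Context: $\mathrm{zer}F:=\{y\in X\mid F(y)=0\}$. ''$a\to0$ whenever $H(a)\to0$'' means that for every $\varepsilon>0$ there is $\delta>0$ such that $H(a)<\delta$ implies $a<\varepsilon$ for all $a\geq0$. A map $x:[0,\infty)\to X$ is $(G,H)$-quasi-Fejér monotone w.r.t. $F$ with error function $e$ (a real-valued function of pairs $0\leq s\leq t$ with $\lim_{t\geq s\to\infty}e(s,t)=0$) if $H(d(x(t),y))\leq G(d(x(s),y))+e(s,t)$ for all $t\geq s\geq0$ and all $y\in\mathrm{zer}F$. *)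

(* Defs.v *)
From HB Require Import structures.
From mathcomp Require Import all_boot all_order all_algebra.
From mathcomp Require Import all_classical all_reals all_analysis.

Set Implicit Arguments.
Unset Strict Implicit.
Unset Printing Implicit Defensive.

Import Order.TTheory GRing.Theory Num.Theory.
Import numFieldNormedType.Exports.

Local Open Scope classical_set_scope.
Local Open Scope ring_scope.

(* Functions on [0, +oo[ (resp. on pairs 0 <= s <= t) are total functions of
   which only the values on that domain are constrained; accordingly,
   continuity is continuity within the domain. *)

Definition zer (R : realType) (X : Type) (F : X -> \bar R) : set X :=
  [set y | F y = 0%E].

(* "g a -> 0 whenever f a -> 0", for a ranging over [0, +oo[ *)
Definition tends0_whenever (R : realType) (g f : R -> R) : Prop :=
  forall eps : R, 0 < eps -> exists2 delta : R, 0 < delta &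
    forall a : R, 0 <= a -> f a < delta -> g a < eps.

Definition time_pairs (R : realType) : set (R * R) :=
  [set p | 0 <= p.1 /\ p.1 <= p.2].

(* lim e(s, t) = 0 as s, t -> +oo subject to 0 <= s <= t *)
Definition error_function (R : realType) (e : R * R -> R) : Prop :=
  e p @[p --> within (@time_pairs R)
                    (filter_prod (pinfty_nbhs R) (pinfty_nbhs R))]
    --> (0 : R).

Definition quasi_fejer_monotone (R : realType) (X : metricType R)
    (G H : R -> R) (F : X -> \bar R) (e : R * R -> R) (x : R -> X) : Prop :=
  error_function e /\
  forall s t : R, 0 <= s -> s <= t -> forall y : X, zer F y ->
    H (mdist (x t) y) <= G (mdist (x s) y) + e (s, t).

(* Main.v *)
Require Import Defs.
From HB Require Import structures.
From mathcomp Require Import all_boot all_order all_algebra.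
From mathcomp Require Import all_classical all_reals all_analysis.

(** A zero of [F] that the trajectory approaches at arbitrarily late times must
    be its limit. Fix such a zero [y] and pick a late time [s] at which
    [x s] is so close to [y] that [G (mdist (x s) y)] is tiny; monotonicity
    against [y] then makes [H (mdist (x t) y)] tiny for all [t >= s] at once,
    because the error [e (s, t)] is uniformly small for late [s], and smallness
    of [H] forces smallness of the distance
    ([quasi_fejer_cvg_of_cluster]).

    Such a zero exists by compactness ([cluster_zero_of_limf_einf]): the lower
    limit being [0], the trajectory is frequently in the sublevel sets
    [F < eps], so the late times lying in those sets generate a proper filter;
    any cluster point of [x] along it is a cluster point of the whole
    trajectory, and continuity of [F] makes it a zero. *)

Set Implicit Arguments.
Unset Strict Implicit.
Unset Printing Implicit Defensive.

Import Order.TTheory GRing.Theory Num.Theory.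
Import numFieldNormedType.Exports.

Local Open Scope classical_set_scope.
Local Open Scope ring_scope.

Lemma limf_einf_lt_meets (R : realType) (T : topologicalType)
    (P : set_system T) (f : T -> \bar R) (a : \bar R) (A : set T) :
  (limf_einf f P < a)%E -> P A -> exists2 t, A t & (f t < a)%E.
Proof.
move=> fa PA; have : (ereal_inf (f @` A) < a)%E.
  apply: le_lt_trans fa; rewrite limf_einfE.
  by apply: ereal_sup_ubound; exists A.
by move=> /ereal_inf_lt[_ [t At <-]] fta; exists t.
Qed.

(** The frequently visited sublevel sets of [F] are turned into a filter finer
    than [P], so that a single appeal to compactness yields a point that is both
    a cluster point and a zero. *)
Lemma cluster_zero_of_limf_einf (R : realType) (X : topologicalType)
    (T : topologicalType) (P : set_system T) (F : X -> \bar R) (x : T -> X) :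
  Filter P -> compact [set: X] -> (forall y, (0 <= F y)%E) -> continuous F ->
  limf_einf (F \o x) P = 0%E -> exists2 y, zer F y & cluster (x @ P) y.
Proof.
move=> PF compactX F_ge0 F_cont liminf0.
pose Q := filter_from [set i : set T * R | P i.1 /\ 0 < i.2]
  (fun i => [set t | i.1 t /\ (F (x t) < i.2%:E)%E]).
have QF : ProperFilter Q.
  apply: filter_from_proper; last first.
    move=> [A eps] /= [PA eps_gt0].
    have [|t At Ft] := @limf_einf_lt_meets _ _ P (F \o x) eps%:E A _ PA.
      by rewrite liminf0 lte_fin.
    by exists t.
  apply: filter_from_filter.
    by exists (setT, 1); split => //=; exact: filterT.
  move=> [A a] [B b] /= [PA a_gt0] [PB b_gt0].
  exists (A `&` B, Num.min a b) => /=.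
    by split; [exact: filterI | rewrite lt_min a_gt0 b_gt0].
  by move=> t /= [[At Bt]]; rewrite EFin_min lt_min => /andP[].
have [y [_ y_cluster]] := compactX (x @ Q) _ filterT.
exists y.
  apply/eqP; rewrite eq_le F_ge0 andbT; apply/lee_addgt0Pr => eps eps_gt0.
  rewrite add0e leNgt; apply/negP => eps_lt.
  have Q_lt : (x @ Q) [set z | (F z < eps%:E)%E].
    by exists (setT, eps) => /= [|t []//]; split => //; exact: filterT.
  have y_gt : nbhs y [set z | (eps%:E < F z)%E].
    apply: (F_cont y [set z | (eps%:E < z)%E]); apply: open_nbhs_nbhs; split => //.
    exact: open_ereal_gt_ereal.
  have [z [/= z_lt z_gt]] := y_cluster _ _ Q_lt y_gt.
  by have := lt_trans z_lt z_gt; rewrite ltxx.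
move=> A B xPA yB; apply: y_cluster => //.
by exists (x @^-1` A, 1) => /= [|t []//].
Qed.

Lemma error_function_lt (R : realType) (e : R * R -> R) (eps : R) :
  error_function e -> 0 < eps ->
  \forall N \near +oo, forall s t, N <= s -> s <= t -> e (s, t) < eps.
Proof.
move=> e0 eps_gt0.
have /cvgrPdist_lt/(_ _ eps_gt0) [[A B] [/= [a [_ aA]] [b [_ bB]]] AB] := e0.
near=> N.
have aN : a < N by near: N; exact: nbhs_pinfty_gt (num_real a).
have bN : b < N by near: N; exact: nbhs_pinfty_gt (num_real b).
have N_ge0 : 0 <= N by near: N; exact: nbhs_pinfty_ge.
move=> s t Ns st; have := AB (s, t); rewrite /= sub0r normrN.
move=> /(_ _ _)/(le_lt_trans (ler_norm _)); apply.
  split; first exact: aA (lt_le_trans aN Ns).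
  exact: bB (lt_le_trans bN (le_trans Ns st)).
by split; first exact: le_trans Ns.
Unshelve. all: by end_near. Qed.

(** The error bound holds for all [t >= s] simultaneously, so one visit of the
    trajectory near [y] traps it there. *)
Lemma quasi_fejer_cvg_of_cluster (R : realType) (X : metricType R)
    (G H : R -> R) (F : X -> \bar R) (e : R * R -> R) (x : R -> X) (y : X) :
  tends0_whenever (fun a : R => a) H -> tends0_whenever G (fun a : R => a) ->
  quasi_fejer_monotone G H F e x -> zer F y ->
  cluster (x @ +oo) y -> x t @[t --> +oo] --> y.
Proof.
move=> H_vanish G_vanish [e0 x_fejer] Fy0 y_cluster.
apply/metricType_numDomainType.cvgrPdist_lt => eps eps_gt0.
have [d d_gt0 Hd] := H_vanish _ eps_gt0.
have d2_gt0 : 0 < d / 2 by rewrite divr_gt0.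
have [r r_gt0 Gr] := G_vanish _ d2_gt0.
have [N [/= N_ge0 e_lt]] : exists N, 0 <= N /\
    forall s t, N <= s -> s <= t -> e (s, t) < d / 2.
  apply/(@filter_ex _ (pinfty_nbhs R)); near=> N; split.
    by near: N; exact: nbhs_pinfty_ge.
  by near: N; exact: error_function_lt.
have x_late : (x @ +oo) (x @` [set s | N <= s]).
  have := nbhs_pinfty_ge (num_real N).
  by apply: filterS => s Ns; exists s.
have [_ [[s /= Ns <-] ys]] := y_cluster _ _ x_late (nbhsx_ballx y r r_gt0).
have xs_lt : mdist (x s) y < r.
  by rewrite metric_sym; move: ys; rewrite ballEmdist.
have s_ge0 : 0 <= s := le_trans N_ge0 Ns.
near=> t.
have st : s <= t by near: t; exact: nbhs_pinfty_ge (num_real s).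
rewrite metric_sym; apply: Hd; first exact: mdist_ge0.
apply: le_lt_trans (x_fejer _ _ s_ge0 st _ Fy0) _.
by rewrite (splitr d) ltrD// ?e_lt// Gr// mdist_ge0.
Unshelve. all: by end_near. Qed.


Theorem theorem3p10 (R : realType) (X : metricType R)
    (F : X -> \bar R) (G H : R -> R) (x : R -> X) (e : R * R -> R)
    (compactX : compact [set: X])
    (F_ge0 : forall y : X, (0 <= F y)%E)
    (F_cont : continuous F)
    (G_ge0 : forall a : R, 0 <= a -> 0 <= G a)
    (H_ge0 : forall a : R, 0 <= a -> 0 <= H a)
    (G_cont : {within `[0, +oo[, continuous G})
    (H_cont : {within `[0, +oo[, continuous H})
    (H_vanish : tends0_whenever (fun a : R => a) H)
    (G_vanish : tends0_whenever G (fun a : R => a))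
    (x_cont : {within `[0, +oo[, continuous x})
    (liminf_Fx : limf_einf (fun t : R => F (x t)) (pinfty_nbhs R) = 0%E)
    (e_cont : {within @time_pairs R, continuous e})
    (x_fejer : quasi_fejer_monotone G H F e x) :
  exists2 y : X, zer F y & x t @[t --> +oo] --> y.
Proof.
have [y Fy0 y_cluster] :=
  cluster_zero_of_limf_einf _ compactX F_ge0 F_cont liminf_Fx.
exists y => //.
exact: quasi_fejer_cvg_of_cluster H_vanish G_vanish x_fejer Fy0 y_cluster.
Qed.
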